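(* Let ${\cal O}\subseteq{\it HML}_{\it FDP}$. Then the Approximation Induction Principle is sound for $\sim_{\cal O}$: for any labelled transition system and any states $s,q$ of its projection closure, if $\pi_n(s)\sim_{\cal O}\pi_n(q)$ for all $n\in\mathbb{N}$, then $s\sim_{\cal O}q$.
   Context: A labelled transition system consists of a set $S$ of states, a set $A$ of actions and transitions $s\xrightarrow{a}s'$. For each $n\in\mathbb{N}$ there is a projection operator $\pi_n$; the projection closure of the LTS has as states all expressions obtained from states of $S$ by finitely many applications of the operators $\pi_n$, with the original transitions together with the transitions given by the rule: if $x\xrightarrow{a}x'$ then $\pi_{n+1}(x)\xrightarrow{a}\pi_n(x')$ (these are the only transitions of projected states). Hennessy-Milner logic ${\it HML}$ has formulas $\varphi ::= {\sf T} \mid \bigwedge_{i\in I}\varphi_i \mid \langle a\rangle\varphi \mid \neg\varphi$ ($a\in A$, $I$ arbitrary index set), with the usual satisfaction relation ($s\models\langle a\rangle\varphi$ iff some $a$-successor of $s$ satisfies $\varphi$, conjunction and negation classical). The depth is $d({\sf T})=0$, $d(\bigwedge_{i\in I}\varphi_i)=\sup_i d(\varphi_i)$, $d(\langle a\rangle\varphi)=1+d(\varphi)$, $d(\neg\varphi)=d(\varphi)$; ${\it HML}_{\it FDP}$ is the set of formulas of finite depth. For ${\cal O}\subseteq{\it HML}$, $s\sim_{\cal O}q$ means $s$ and $q$ satisfy exactly the same formulas of ${\cal O}$. *)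

(* Defs.v *)
From mathcomp Require Import all_boot.
From mathcomp Require Import boolp classical_sets.

Set Implicit Arguments.
Unset Strict Implicit.
Unset Printing Implicit Defensive.

Local Open Scope classical_set_scope.

Record lts (A : Type) := LTS {
  state :> Type;
  trans : state -> A -> state -> Prop
}.

(* States of the projection closure are formal expressions
   pi_n1 (pi_n2 (... s)), so that syntactically different expressions are
   different states. *)
Inductive proj_expr (S : Type) : Type :=
| Base : S -> proj_expr S
| Proj : nat -> proj_expr S -> proj_expr S.

Inductive proj_trans (A : Type) (M : lts A) :
    proj_expr M -> A -> proj_expr M -> Prop :=
| trans_base s a s' :
    trans s a s' -> proj_trans (Base s) a (Base s')
| trans_proj n x a x' :
    proj_trans x a x' -> proj_trans (Proj n.+1 x) a (Proj n x').

Definition proj_closure (A : Type) (M : lts A) : lts A :=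
  LTS (@proj_trans A M).

Definition proj (A : Type) (M : lts A) (n : nat) (x : proj_closure M) :
  proj_closure M := Proj n x.

Inductive HML (A : Type) : Type :=
| HTrue : HML A
| HConj : forall I : Type, (I -> HML A) -> HML A
| HDiam : A -> HML A -> HML A
| HNeg : HML A -> HML A.

Arguments HTrue {A}.

Fixpoint sat (A : Type) (M : lts A) (s : M) (phi : HML A) : Prop :=
  match phi with
  | HTrue => True
  | HConj J f => forall i : J, sat s (f i)
  | HDiam a psi => exists s' : M, trans s a s' /\ sat s' psi
  | HNeg psi => ~ sat s psi
  end.

(* Depths live in the naturals extended with infinity: [Some n] is the natural
   number n and [None] is infinity. *)
Definition sup_ub (I : Type) (d : I -> option nat) (n : nat) : Prop :=
  forall i, exists2 m, d i = Some m & m <= n.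

(* The supremum of the empty family is [Some 0]. *)
Definition depth_sup (I : Type) (d : I -> option nat) : option nat :=
  match pselect (exists n, `[< sup_ub d n >]) with
  | left bounded => Some (ex_minn bounded)
  | right _ => None
  end.

Fixpoint depth (A : Type) (phi : HML A) : option nat :=
  match phi with
  | HTrue => Some 0
  | HConj J f => depth_sup (fun i : J => depth (f i))
  | HDiam _ psi => omap S (depth psi)
  | HNeg psi => depth psi
  end.

Definition HML_FDP (A : Type) : set (HML A) :=
  [set phi | exists n, depth phi = Some n].

Definition hml_equiv (A : Type) (O : set (HML A)) (M : lts A) (s q : M) : Prop :=
  forall phi, O phi -> (sat s phi <-> sat q phi).

(* Main.v *)
(* Whether a formula of depth d holds at a state only depends on the transition
   sequences of length at most d from that state, and these are preserved by
   [Proj n] as soon as d <= n.  So a formula of depth d cannot distinguish s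
   from pi_d(s), nor q from pi_d(q). *)
Require Import Defs.
From mathcomp Require Import all_boot.
From mathcomp Require Import boolp classical_sets.

Set Implicit Arguments.
Unset Strict Implicit.
Unset Printing Implicit Defensive.

Local Open Scope classical_set_scope.

(** A finite supremum is the least natural upper bound, hence itself a bound. *)
Lemma depth_sup_ub (I : Type) (d : I -> option nat) (n : nat) :
  depth_sup d = Some n -> sup_ub d n.
Proof.
rewrite /depth_sup; case: pselect => // bounded [<-].
by case: ex_minnP => m /asboolP.
Qed.

Lemma proj_transS (A : Type) (M : lts A) (n : nat) (x : proj_closure M) (a : A)
    (y : proj_closure M) :
  trans (proj n.+1 x) a y <-> exists2 x', trans x a x' & y = proj n x'.
Proof.
split=> [xy|[x' xx' ->]]; last exact: trans_proj.
by inversion xy; subst; exists x'.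
Qed.

Lemma sat_proj (A : Type) (M : lts A) (phi : HML A) (d n : nat)
    (x : proj_closure M) :
  depth phi = Some d -> d <= n -> sat (proj n x) phi <-> sat x phi.
Proof.
elim: phi d n x => [|J f IH|a psi IH|psi IH] d n x //=.
- move=> /depth_sup_ub f_ub dn.
  (* One [n] serves all conjuncts, even infinitely many: each depth is at most the supremum [d], and
     [d <= n]. *)
  have fE i : sat (proj n x) (f i) <-> sat x (f i).
    by have [m fm md] := f_ub i; apply: IH fm (leq_trans md dn).
  by split=> xf i; apply/fE.
(* Here [d = k.+1], which rules out [n = 0]; a transition then lowers both depth and projection
   index by one. *)
- case psi_d: (depth psi) => [k|] //= [<-]; case: n => // n kn; split.
    move=> [y [/proj_transS[x' xx' ->] /(IH _ _ _ psi_d kn) x'psi]].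
    by exists x'.
  move=> [x' [xx' x'psi]]; exists (proj n x'); split; first exact: trans_proj.
  exact/(IH _ _ _ psi_d kn).
- by move=> psi_d dn; split=> npsi /(IH _ _ _ psi_d dn).
Qed.

Theorem theorem7 (A : Type) (O : set (HML A)) (O_FDP : O `<=` @HML_FDP A)
    (M : lts A) (s q : proj_closure M) :
  (forall n : nat, hml_equiv O (proj n s) (proj n q)) -> hml_equiv O s q.
Proof.
move=> sq phi Ophi; have [d phi_d] := O_FDP _ Ophi.
have [sE qE] := (sat_proj s phi_d (leqnn d), sat_proj q phi_d (leqnn d)).
(* The chain passes through the projections at index [d], the depth of [phi]. *)
by split=> [/sE /(sq d _ Ophi) /qE|/qE /(sq d _ Ophi) /sE].
Qed.
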